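(* For every $n\ge 1$, the map $A\mapsto t_A$ restricts to a bijection between the set of $n\times n$ alternating sign matrices that key-avoid $312$ and the set of gapless monotone triangles of order $n$ (with bottom row $1\,2\,\dots\,n$). Equivalently, the SW key of an $n\times n$ ASM $A$ avoids $312$ if and only if $t_A$ is gapless.
   Context: An alternating sign matrix (ASM) of size $n$ is an $n\times n$ matrix with entries in $\{0,1,-1\}$ such that every row and every column sums to $1$ and the nonzero entries of each row and of each column alternate in sign. Position $(i,j)$ is the $i$-th row from the top and $j$-th column from the left. The permutation matrix of $\sigma=\sigma(1)\dots\sigma(n)$ has a $1$ in row $i$, column $\sigma(i)$ for each $i$. A permutation $\sigma$ contains $\pi=\pi(1)\dots\pi(k)$ if there are indices $i_1<\dots<i_k$ with $\sigma(i_a)<\sigma(i_b)$ iff $\pi(a)<\pi(b)$; otherwise $\sigma$ avoids $\pi$. SW key process: a $-1$ entry is removable if no other $-1$ entry lies weakly southwest of it (weakly below and weakly to the left). For a removable $-1$ at $(i,j)$, let $(i,j_0)$ be the nearest $1$ to its west in its row and $(i_0,j)$ the nearest $1$ below it in its column; its neighboring $1$s are the $1$ entries weakly southwest of it such that no other $1$ entry lies both weakly northeast of them and weakly southwest of the $-1$. Consider the $1$s at $(i,j_0)$, $(i_0,j)$ and the neighboring $1$s lying in the rectangle of rows $i..i_0$ and columns $j_0..j$. Replace the south-most of these $1$s by $0$; then moving east to west, for each subsequent one of these $1$s, in column $c$ say, place a new $1$ in the row of the previously replaced $1$ and column $c$, and replace the old $1$ in column $c$ by $0$; finally replace the $-1$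 by $0$. The result is again an ASM. Repeating until no $-1$ remains yields a permutation matrix, independent of the order of removals, called the SW key of $A$. An ASM key-avoids $\pi$ if its SW key avoids $\pi$. A monotone triangle of order $n$ is a left-aligned triangular array of integers with $n$ rows, the $i$-th row from the top having $i$ entries, such that rows strictly increase left to right, columns weakly increase from bottom to top, entries along each northwest–southeast diagonal weakly increase from top to bottom, and the bottom row is $1\,2\,\dots\,n$. For an ASM $A$, let $B$ be the matrix with $B_{i,j}=\sum_{k\le i}A_{k,j}$ (a $0$-$1$ matrix); $t_A$ is the monotone triangle whose $i$-th row lists, increasingly, the column indices $j$ with $B_{i,j}=1$. A monotone triangle is gapless if in each of its columns the set of entries is an interval of integers. *)

(* Defs.v *)
From Stdlib Require Import Relation_Operators.
From mathcomp Require Import all_boot all_order all_algebra all_fingroup.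

Set Implicit Arguments.
Unset Strict Implicit.
Unset Printing Implicit Defensive.

Import Order.TTheory GRing.Theory Num.Theory.
Local Open Scope ring_scope.

(* Rows and columns are indexed from 0: the pair (i, j) stands for row i + 1   *)
(* from the top and column j + 1 from the left.                                *)

Section ASM.

Variable n : nat.
Implicit Types (A : 'M[int]_n) (i j : 'I_n) (m p q : 'I_n * 'I_n).

Definition alternating (f : 'I_n -> int) : Prop :=
  forall j1 j2 : 'I_n, (j1 < j2)%N -> f j1 != 0 -> f j2 != 0 ->
    (forall j : 'I_n, (j1 < j < j2)%N -> f j = 0) ->
    Num.sg (f j2) = - Num.sg (f j1).

Definition is_asm A : Prop :=
  [/\ forall i j, A i j \in [:: 0; 1; -1],
      forall i, \sum_j A i j = 1,
      forall j, \sum_i A i j = 1,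
      forall i, alternating (fun j => A i j)
    & forall j, alternating (fun i => A i j)].

(* p lies weakly southwest of q. *)
Definition weakly_SW p q : bool := (q.1 <= p.1)%N && (p.2 <= q.2)%N.

Definition removable A m : Prop :=
  A m.1 m.2 = -1 /\
  forall p, A p.1 p.2 = -1 -> weakly_SW p m -> p = m.

Definition nearest_west_one A i j (j0 : 'I_n) : Prop :=
  [/\ (j0 < j)%N, A i j0 = 1 &
      forall j' : 'I_n, (j0 < j' < j)%N -> A i j' <> 1].

Definition nearest_south_one A i j (i0 : 'I_n) : Prop :=
  [/\ (i < i0)%N, A i0 j = 1 &
      forall i' : 'I_n, (i < i' < i0)%N -> A i' j <> 1].

Definition neighboring A m p : bool :=
  [&& A p.1 p.2 == 1, weakly_SW p m
    & [forall q, [&& A q.1 q.2 == 1, weakly_SW p q & weakly_SW q m]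
                   ==> (q == p)]].

Definition moved_ones A i j (i0 j0 : 'I_n) : {set 'I_n * 'I_n} :=
  [set p | [|| p == (i, j0), p == (i0, j)
             | [&& neighboring A (i, j) p,
                   (i <= p.1 <= i0)%N & (j0 <= p.2 <= j)%N]]].

Definition set_entry A (r c : 'I_n) (v : int) : 'M[int]_n :=
  \matrix_(k, l) if (k == r) && (l == c) then v else A k l.

(* r is the row of the 1 replaced last; s lists the remaining 1s.              *)
Fixpoint shift_ones A (r : 'I_n) (s : seq ('I_n * 'I_n)) : 'M[int]_n :=
  if s is (r', c) :: s' then
    shift_ones (set_entry (set_entry A r c 1) r' c 0) r' s'
  else A.

(* The moved 1s are pairwise incomparable for weakly_SW, so they have distinct *)
(* columns and the east-most of them, which comes first in the sorted list, is *)
(* also the south-most.                                                        *)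
Definition remove_neg A i j (i0 j0 : 'I_n) : 'M[int]_n :=
  if sort (fun p q => (q.2 <= p.2)%N) (enum (moved_ones A i j i0 j0))
    is (r, c) :: s
  then set_entry (shift_ones (set_entry A r c 0) r s) i j 0
  else A.

Definition SW_step A A' : Prop :=
  exists i j i0 j0 : 'I_n,
    [/\ removable A (i, j), nearest_west_one A i j j0,
        nearest_south_one A i j i0 & A' = remove_neg A i j i0 j0].

(* The removals may be made in any order. The process stops at a permutation   *)
(* matrix; perm_mx s has its 1 of row i in column s i.                         *)
Definition SW_key A (s : 'S_n) : Prop :=
  clos_refl_trans _ SW_step A (perm_mx s).

(* The pattern pi is given in one-line notation.                               *)
Definition contains (s : 'S_n) (pi : seq nat) : Prop :=
  exists f : 'I_(size pi) -> 'I_n,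
    (forall a b : 'I_(size pi), (a < b)%N -> (f a < f b)%N) /\
    (forall a b : 'I_(size pi),
       (s (f a) < s (f b))%N <-> (nth 0%N pi a < nth 0%N pi b)%N).

Definition avoids (s : 'S_n) (pi : seq nat) : Prop := ~ contains s pi.

Definition key_avoids A (pi : seq nat) : Prop :=
  exists s : 'S_n, SW_key A s /\ avoids s pi.

Definition col_partial_sum A i j : int := \sum_(k < n | (k <= i)%N) A k j.

(* The list of the rows of t_A, from top to bottom; the entries are column     *)
(* indices counted from 1.                                                     *)
Definition triangle_of A : seq (seq nat) :=
  [seq [seq (nat_of_ord j).+1 | j <- enum 'I_n & col_partial_sum A i j == 1]
     | i <- enum 'I_n].

End ASM.

Definition entry (t : seq (seq nat)) (i c : nat) : nat :=
  nth 0%N (nth [::] t i) c.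

(* Integer entries are necessarily positive, being bounded below by the entry  *)
(* of the bottom row in the same column; hence the type nat.                   *)
Definition monotone_triangle (n : nat) (t : seq (seq nat)) : Prop :=
  [/\ size t = n /\ forall i, (i < n)%N -> size (nth [::] t i) = i.+1,
      forall i c, (i < n)%N -> (c < i)%N -> (entry t i c < entry t i c.+1)%N,
      forall i c, (i.+1 < n)%N -> (c <= i)%N ->
        (entry t i.+1 c <= entry t i c)%N,
      forall i c, (i.+1 < n)%N -> (c <= i)%N ->
        (entry t i c <= entry t i.+1 c.+1)%N
    & nth [::] t n.-1 = iota 1 n].

(* Column c of a triangle of order n meets the rows c, ..., n - 1.             *)
Definition gapless (n : nat) (t : seq (seq nat)) : Prop :=
  forall c i1 i2 v : nat, (c <= i1 < n)%N -> (c <= i2 < n)%N ->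
    (entry t i1 c <= v <= entry t i2 c)%N ->
    exists2 i, (c <= i < n)%N & entry t i c = v.

(* Main.v *)
From Stdlib Require Import Relation_Operators.
Require Import Defs.
From mathcomp Require Import all_boot all_order all_algebra all_fingroup.
From mathcomp Require Import classical_sets functions zify.

(* Everything is read off the corner sums [C u v], the sums of the entries in  *)
(* the first [u] rows and the first [v] columns. ASMs correspond to the        *)
(* functions [C] with the right boundary values whose horizontal and vertical  *)
(* increments are 0 or 1, and column [c] of [t_A] skips a value exactly when   *)
(* [C k x.+1 < C k.+1 x] and [C k x.+1 < k] for some [k] and [x], with         *)
(* [c = C k x.+1]: call this a gap. For a permutation matrix a gap is an       *)
(* occurrence of 312, with the 1 in row [k] and the 2 in column [x].           *)
(*                                                                             *)
(* Removing a removable [-1] at [(i, j)] lowers [C] by 1 at those corners      *)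
(* [(u, v)] with [i < u] and [v <= j] for which the rows [i, ..., u - 1] and   *)
(* columns [v, ..., j] contain no 1, and nowhere else. This preserves ASMs and *)
(* the existence of a gap, in both directions: gaps destroyed by the removal   *)
(* lie in row [i] or column [j] and slide to the border of the lowered region, *)
(* and conversely. Hence every run of the process, whatever the order of the   *)
(* removals, decides gaplessness by the pattern 312 of the final permutation.  *)

Set Implicit Arguments.
Unset Strict Implicit.
Unset Printing Implicit Defensive.

Import Order.TTheory GRing.Theory Num.Theory.
Local Open Scope ring_scope.

(** * Corner functions *)

(** Alternating sign matrices and monotone triangles are two encodings of the same functions
    [corner]. On the matrix side the boundary values and the 0-or-1 increments say exactly that row
    and column prefix sums lie in {0, 1} with total 1 ([asm_corner], [corner_asm]). On the triangle
    side [C u v] counts the entries [<= v] in the first-[u]-rows row, and the interlacing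
    inequalities become the same conditions ([csum_triangle_of], [monotone_corner]). This gives the
    bijection with all monotone triangles, and what remains is to match the two restrictions.

    Columns of a triangle weakly decrease downward, so a missing value is jumped over between two
    adjacent rows; in terms of [C] that jump is a [gap] ([gapless_has_gap]). For a permutation
    matrix a gap is an occurrence of 312 ([has_gap_perm]). The link is the key process: one removal
    acts on [C] as [lower] ([csum_remove_neg]), and gaps exist after it if and only if they existed
    before ([has_gap_lower], [has_gap_of_lower]). Each removal decreases the total of the corner
    sums, so the process ends, and it can only end at a permutation matrix ([SW_key_exists]). *)

Section CornerFunctions.

Variable n : nat.
Implicit Types (C : nat -> nat -> int) (u v k x : nat).

Record corner C : Prop := Corner {
  corner0l : forall v, (v <= n)%N -> C 0%N v = 0;
  corner0r : forall u, (u <= n)%N -> C u 0%N = 0;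
  cornernl : forall v, (v <= n)%N -> C n v = v%:Z;
  cornernr : forall u, (u <= n)%N -> C u n = u%:Z;
  cornerSl : forall u v, (u < n)%N -> (v <= n)%N -> C u v <= C u.+1 v <= C u v + 1;
  cornerSr : forall u v, (u <= n)%N -> (v < n)%N -> C u v <= C u v.+1 <= C u v + 1
}.

Definition mixed_diff C u v : int :=
  C u.+1 v.+1 - C u v.+1 - C u.+1 v + C u v.

Definition gap C k x : bool := (C k x.+1 < C k.+1 x) && (C k x.+1 < k%:Z).

Definition has_gap C : Prop :=
  exists k x, [/\ (k < n)%N, (x < n)%N & gap C k x].

Lemma corner_le C u v : corner C -> (u <= n)%N -> (v <= n)%N ->
  0 <= C u v <= u%:Z.
Proof.
move=> cC; elim: u => [_ vn|u IHu un vn]; first by rewrite corner0l.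
by have := IHu (ltnW un) vn; have := cornerSl cC un vn; lia.
Qed.

Lemma corner_ler C u v w : corner C -> (u <= n)%N -> (v <= w <= n)%N ->
  C u v <= C u w.
Proof.
move=> cC un /andP[vw]; elim: w vw => [|w IHw] vw wn.
  by have -> : v = 0%N by lia.
have [->//|vw'] : v = w.+1 \/ (v <= w)%N by lia.
by have := IHw vw' (ltnW wn); have := cornerSr cC un wn; lia.
Qed.

Lemma corner_leS C u w v : corner C -> (u <= w <= n)%N -> (v <= n)%N ->
  C w v <= C u v + (w - u)%N%:Z.
Proof.
move=> cC /andP[uw wn] vn; elim: w uw wn => [|w IHw] uw wn.
  have -> : u = 0%N by lia.
  by rewrite addr0.
have [->|uw'] : u = w.+1 \/ (u <= w)%N by lia.
  by lia.
by have := IHw uw' (ltnW wn); have := cornerSl cC wn vn; lia.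
Qed.

(** The strict inequality is squeezed between [C k x] and [C k x + 1]. For a matrix: column [x] sums
    to 0 above row [k], row [k] sums to 1 left of column [x], and the entry at [(k, x)] is 0. *)
Lemma gap_eq C k x : corner C -> (k < n)%N -> (x < n)%N -> gap C k x ->
  [/\ C k x.+1 = C k x, C k.+1 x = C k x + 1 & C k.+1 x.+1 = C k x + 1].
Proof.
move=> cC kn xn /andP[g _].
have := cornerSl cC kn (ltnW xn); have := cornerSl cC kn xn.
have := cornerSr cC (ltnW kn) xn; have := cornerSr cC kn xn.
by split; lia.
Qed.

(** * The region of corners lowered by one removal *)

Section Removal.

Variables (C : nat -> nat -> int) (i j : nat).
Hypotheses (cC : corner C) (lt_in : (i < n)%N) (lt_jn : (j < n)%N).
Hypothesis neg_ij : mixed_diff C i j = -1.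
Hypothesis nonneg_SW : forall u v, (i <= u < n)%N -> (v <= j)%N ->
  (u != i) || (v != j) -> 0 <= mixed_diff C u v.

(* For [C] the corner sums of a matrix [A], the sum of [A] over the rows       *)
(* [i <= k < u] and the columns [v <= l <= j].                                 *)
Definition rect u v : int := C u j.+1 - C u v - C i j.+1 + C i v.

(* The corners at which removing the [-1] at [(i, j)] lowers the corner sum.   *)
Definition lowered u v : bool := [&& (i < u)%N, (v <= j)%N & rect u v == -1].

Definition lower u v : int := C u v - (lowered u v)%:Z.

Definition row_strip u v : int := C u.+1 j.+1 - C u j.+1 - C u.+1 v + C u v.

Lemma row_stripE u v : row_strip u v = mixed_diff C u v + row_strip u v.+1.
Proof. by rewrite /row_strip /mixed_diff; lia. Qed.

Lemma row_strip_end u : row_strip u j.+1 = 0.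
Proof. by rewrite /row_strip; lia. Qed.

Lemma rectS u v : rect u.+1 v = rect u v + row_strip u v.
Proof. by rewrite /rect /row_strip; lia. Qed.

Lemma rect_start v : rect i v = 0.
Proof. by rewrite /rect; lia. Qed.

Lemma row_strip_mono u v w : (i < u < n)%N -> (v <= w <= j.+1)%N ->
  row_strip u w <= row_strip u v.
Proof.
move=> un /andP[vw wj]; elim: w vw wj => [|w IHw] vw wj.
  by have -> : v = 0%N by lia.
have [->//|vw'] : v = w.+1 \/ (v <= w)%N by lia.
apply: le_trans (IHw vw' (ltnW wj)).
rewrite (row_stripE u w); have := @nonneg_SW u w; lia.
Qed.

Lemma row_strip_ge0 u v : (i < u < n)%N -> (v <= j.+1)%N -> 0 <= row_strip u v.
Proof. by move=> un vj; rewrite -(row_strip_end u) row_strip_mono// vj leqnn. Qed.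

Lemma row_strip_i v w : (v <= w <= j)%N -> row_strip i w <= row_strip i v.
Proof.
move=> /andP[vw wj]; elim: w vw wj => [|w IHw] vw wj.
  by have -> : v = 0%N by lia.
have [->//|vw'] : v = w.+1 \/ (v <= w)%N by lia.
apply: le_trans (IHw vw' (ltnW wj)).
rewrite (row_stripE i w); have := @nonneg_SW i w; lia.
Qed.

Lemma row_strip_ij : row_strip i j = -1.
Proof. by rewrite row_stripE row_strip_end neg_ij. Qed.

Lemma rect_monol u w v : (i < u <= w)%N -> (w <= n)%N -> (v <= j)%N ->
  rect u v <= rect w v.
Proof.
move=> /andP[iu uw] wn vj; elim: w uw wn => [|w IHw] uw wn.
  by have -> : u = 0%N by lia.
have [->//|uw'] : u = w.+1 \/ (u <= w)%N by lia.
have := IHw uw' (ltnW wn); rewrite rectS.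
have := @row_strip_ge0 w v; lia.
Qed.

Lemma rect_ge u v : (i < u <= n)%N -> (v <= j)%N -> -1 <= rect u v.
Proof.
move=> /andP[iu un] vj; have iu1 : (i < i.+1 <= u)%N by lia.
have := rect_monol iu1 un vj; rewrite rectS rect_start -row_strip_ij.
have := @row_strip_i v j; lia.
Qed.

Lemma rect_monor u v : (i <= u <= n)%N -> (v < j)%N -> rect u v.+1 <= rect u v.
Proof.
move=> /andP[iu un] vj; elim: u iu un => [|u IHu] iu un.
  have -> : 0%N = i by lia.
  by rewrite !rect_start.
have [<-|iu'] : i = u.+1 \/ (i <= u)%N by lia.
  by rewrite !rect_start.
have := IHu iu' (ltnW un); rewrite !rectS (row_stripE u v).
have := @nonneg_SW u v; lia.
Qed.

(** The only negative entry of the rectangle is the [-1] in its northeast corner, so a single [1]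
    compensates it. With [one_of_rect], [rect] equals [-1] exactly on rectangles without a [1]. *)
Lemma rect_one u v k l : (i <= k < u)%N -> (u <= n)%N -> (v <= l <= j)%N ->
  mixed_diff C k l = 1 -> 0 <= rect u v.
Proof.
move=> /andP[ik ku] un /andP[vl lj] one.
have vj := leq_trans vl lj.
have iku : (i < k.+1 <= u)%N by lia.
apply: le_trans (rect_monol iku un vj); rewrite rectS.
have [eki|nki] := eqVneq k i.
  move: one; rewrite eki rect_start => one.
  have lj' : (l < j)%N.
    by rewrite ltn_neqAle lj andbT; apply/eqP => e; move: one; rewrite e neg_ij.
  have := @row_strip_i v l; have := @row_strip_i l.+1 j.
  by rewrite row_strip_ij (row_stripE i l) one; lia.
have := @rect_ge k v; have := @row_strip_mono k v l; have := @row_strip_ge0 k l.+1.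
by rewrite (row_stripE k l) one; lia.
Qed.

Lemma row_strip_pos u v w : (v <= w <= j.+1)%N -> row_strip u w < row_strip u v ->
  exists2 l, (v <= l < w)%N & 0 < mixed_diff C u l.
Proof.
move=> /andP[vw wj]; elim: w vw wj => [|w IHw] vw wj.
  have -> : v = 0%N by lia.
  by rewrite ltxx.
have [->|vw'] : v = w.+1 \/ (v <= w)%N by lia.
  by lia.
move=> lt; have [pos|npos] := boolP (0 < mixed_diff C u w).
  by exists w => //; lia.
have [|l vl lpos] := IHw vw' (ltnW wj); last by exists l => //; lia.
by move: lt; rewrite (row_stripE u w); lia.
Qed.

Lemma one_of_rect u v : (i < u <= n)%N -> (v <= j)%N -> 0 <= rect u v ->
  exists k l, [/\ (i <= k < u)%N, (v <= l <= j)%N & 0 < mixed_diff C k l].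
Proof.
move=> /andP[iu un] vj; elim: u iu un => [//|u IHu] iu un.
have [<-|iu'] : i = u \/ (i < u)%N by lia.
  rewrite rectS rect_start add0r => r0.
  have vjj : (v <= j <= j.+1)%N by lia.
  have [|l vl lp] := @row_strip_pos i v j vjj; first by rewrite row_strip_ij; lia.
  by exists i, l; split => //; lia.
rewrite rectS => r0; have [r1|r1] := boolP (0 <= rect u v).
  have [k [l [ku lj kl]]] := IHu iu' (ltnW un) r1.
  by exists k, l; split => //; lia.
have vjj : (v <= j.+1 <= j.+1)%N by lia.
have [|l vl lp] := @row_strip_pos u v j.+1 vjj; first by rewrite row_strip_end; lia.
by exists u, l; split => //; lia.
Qed.

(** Shrinking the rectangle cannot increase [rect], which never drops below [-1]; so the lowered
    corners form a staircase with northeast corner [(i.+1, j)]. *)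
Lemma lowered_north u v : (i < u < n)%N -> lowered u.+1 v -> lowered u v.
Proof.
move=> iun /and3P[_ vj /eqP r]; apply/and3P; split=> //; first by lia.
have := @rect_ge u v; have := @rect_monol u u.+1 v; lia.
Qed.

Lemma lowered_east u v : (u <= n)%N -> (v < j)%N -> lowered u v -> lowered u v.+1.
Proof.
move=> un vj /and3P[iu _ /eqP r]; apply/and3P; split=> //.
have := @rect_ge u v.+1; have := @rect_monor u v; lia.
Qed.

Lemma lowered_north_trans u w v : (i < u <= w)%N -> (w <= n)%N ->
  lowered w v -> lowered u v.
Proof.
move=> /andP[iu uw]; elim: w uw => [|w IHw] uw wn.
  by have -> : u = 0%N by lia.
have [->//|uw'] : u = w.+1 \/ (u <= w)%N by lia.
by move=> /lowered_north L; apply: IHw; [|exact: ltnW|apply: L]; lia.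
Qed.

Lemma lowered_east_trans u v w : (u <= n)%N -> (v <= w <= j)%N ->
  lowered u v -> lowered u w.
Proof.
move=> un /andP[vw wj] L; elim: w vw wj => [|w IHw] vw wj.
  by have <- : v = 0%N by lia.
have [<-//|vw'] : v = w.+1 \/ (v <= w)%N by lia.
by apply: lowered_east => //; apply: IHw => //; exact: ltnW.
Qed.

Lemma lowered_ij : lowered i.+1 j.
Proof. by rewrite /lowered ltnSn leqnn rectS rect_start row_strip_ij. Qed.

Lemma lowered0l v : lowered 0 v = false.
Proof. by rewrite /lowered ltn0. Qed.

Lemma lowered0r u : (u <= n)%N -> lowered u 0 = false.
Proof.
move=> un; apply/negP => /and3P[iu _ /eqP]; rewrite /rect !corner0r //; last lia.
have {iu} iun : (i <= u <= n)%N by lia.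
suff : C i j.+1 <= C u j.+1 by lia.
case/andP: iun; elim: u un => [_|u IHu un iu _]; first by case: (i).
have [->//|iu'] : i = u.+1 \/ (i <= u)%N by lia.
have := IHu (ltnW un) iu' (ltnW un); have := cornerSl cC un lt_jn; lia.
Qed.

Lemma lowerednl v : lowered n v = false.
Proof.
apply/negP => /and3P[_ vj /eqP]; rewrite /rect !cornernl //; last lia.
suff : C i j.+1 <= C i v + (j.+1 - v)%N%:Z by lia.
move: vj; move: (j) lt_jn => w; elim: w => [|w IHw] wn vw.
  have -> : v = 0%N by lia.
  by have := cornerSr cC (ltnW lt_in) wn; lia.
have [->|vw'] : v = w.+1 \/ (v <= w)%N by lia.
  by have := cornerSr cC (ltnW lt_in) wn; lia.
by have := IHw (ltnW wn) vw'; have := cornerSr cC (ltnW lt_in) wn; lia.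
Qed.

Lemma lowerednr u : lowered u n = false.
Proof. by rewrite /lowered [(n <= j)%N]leqNgt lt_jn andbF. Qed.

(** Increments change only across the border of the lowered region. There [rect] changes, and since
    the increments of [C] are 0 or 1, this forces the increment concerned to be 0 where it must rise
    and 1 where it must fall. *)
Lemma corner_lower : corner lower.
Proof.
split.
- by move=> v vn; rewrite /lower corner0l// lowered0l.
- by move=> u un; rewrite /lower corner0r// lowered0r.
- by move=> v vn; rewrite /lower cornernl// lowerednl subr0.
- by move=> u un; rewrite /lower cornernr// lowerednr subr0.
- move=> u v un vn; rewrite /lower.
  have H := cornerSl cC un vn; have J := cornerSl cC un lt_jn.
  have iff_uv : (i < u)%N -> lowered u.+1 v -> lowered u v.
    by move=> iu; apply: lowered_north; lia.
  move: iff_uv; rewrite /lowered rectS /row_strip.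
  have [vj|vj] := leqP v j; last by lia.
  have := @rect_ge u v; have := @rect_ge u.+1 v; rewrite rectS /row_strip.
  move: H J; have [<-|ui] := eqVneq i u; first by rewrite rect_start ltnn; lia.
  by lia.
- move=> u v un vn; rewrite /lower.
  have H := cornerSr cC un vn; have I := cornerSr cC (ltnW lt_in) vn.
  have iff_uv : (v < j)%N -> lowered u v -> lowered u v.+1.
    by move=> iu; apply: lowered_east; lia.
  move: iff_uv; rewrite /lowered.
  have [iu|iu] := ltnP i u; last by lia.
  have := @rect_ge u v; have := @rect_ge u v.+1; rewrite /rect.
  move: H I; have [->|vj] := eqVneq v j; first by rewrite ltnn; lia.
  by lia.
Qed.

(** Supplies the second condition of [gap] when a gap is moved to a lowered corner. *)
Lemma corner_lt_lowered u v : (u <= n)%N -> lowered u v -> C u v < u%:Z.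
Proof.
move=> un /and3P[iu vj /eqP]; rewrite /rect.
have := @corner_le C i j.+1 cC; have := @corner_ler C i v j cC.
have := @corner_leS C i.+1 u j.+1 cC.
have := neg_ij; rewrite /mixed_diff.
have := cornerSl cC lt_in lt_jn; have := cornerSl cC lt_in (ltnW lt_jn).
have := cornerSr cC lt_in lt_jn; have := cornerSr cC (ltnW lt_in) lt_jn.
lia.
Qed.

Lemma lower_at_one u v : lowered u v -> lower u v = C u v - 1.
Proof. by rewrite /lower => ->. Qed.

Lemma lower_at_zero u v : ~~ lowered u v -> lower u v = C u v.
Proof. by rewrite /lower => /negbTE ->; rewrite subr0. Qed.

Lemma lowered_last u x : (u <= n)%N -> lowered u x ->
  exists w, [/\ (u <= w < n)%N, lowered w x & ~~ lowered w.+1 x].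
Proof.
move: {-2}(n - u)%N (erefl (n - u)%N) => m; elim: m u => [|m IHm] u em un L.
  have eu : u = n by lia.
  by move: L; rewrite eu lowerednl.
have [L'|L'] := boolP (lowered u.+1 x); last by exists u; split=> //; lia.
have [||w [uw Lw Lw']] := IHm u.+1 _ _ L'; [lia..|].
by exists w; split=> //; lia.
Qed.

Lemma lowered_first u x : (u <= n)%N -> (x <= j)%N -> lowered u x ->
  exists w, [/\ (w < x)%N, lowered u w.+1 & ~~ lowered u w].
Proof.
move=> un; elim: x => [|x IHx] xj L; first by move: L; rewrite lowered0r.
have [L'|L'] := boolP (lowered u x); last by exists x; split.
by have [w [wx Lw Lw']] := IHx (ltnW xj) L'; exists w; split=> //; lia.
Qed.

Lemma neg_at : [/\ C i j.+1 = C i j + 1, C i.+1 j = C i j + 1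
                 & C i.+1 j.+1 = C i j + 1].
Proof.
have := neg_ij; rewrite /mixed_diff.
have := cornerSl cC lt_in lt_jn; have := cornerSl cC lt_in (ltnW lt_jn).
have := cornerSr cC lt_in lt_jn; have := cornerSr cC (ltnW lt_in) lt_jn.
by split; lia.
Qed.

Lemma has_gap_lower : has_gap C -> has_gap lower.
Proof.
move=> [k [x [kn xn g]]].
have [e1 e2 e3] := gap_eq cC kn xn g.
have := cornerSl corner_lower kn (ltnW xn).
have := cornerSl corner_lower kn xn.
have := cornerSr corner_lower (ltnW kn) xn.
have := cornerSr corner_lower kn xn.
(* The gap can be destroyed only when [(k.+1, x)] is lowered and [(k, x.+1)] is not. *)
have [b1|b1] := boolP (lowered k.+1 x); last first.
  move=> h1 h2 h3 h4; exists k, x; split=> //; move: g h1 h2 h3 h4.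
  by rewrite /gap /lower (negbTE b1); lia.
have [b2|b2] := boolP (lowered k x.+1).
  move=> h1 h2 h3 h4; exists k, x; split=> //; move: g h1 h2 h3 h4.
  by rewrite /gap /lower b1 b2; lia.
move=> _ _ _ _.
have /and3P[ik xj _] := b1.
have [eik|nik] := eqVneq i k.
  (* The gap lies in row [i]: it slides down its column to the last lowered    *)
  (* corner.                                                                   *)
  have [w [kw Lw Lw']] := lowered_last kn b1.
  exists w, x; split=> //; [lia|].
  have xj' : (x < j)%N.
    rewrite ltn_neqAle xj andbT; apply/eqP => exj; move: e1 e2 e3.
    by rewrite -eik exj; case: neg_at; lia.
  have Lw1 := lowered_east (ltnW (proj2 (andP kw))) xj' Lw.
  have wn : (w < n)%N by lia.
  have := cornerSl corner_lower wn (ltnW xn).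
  rewrite /gap (lower_at_zero Lw') (lower_at_one Lw) (lower_at_one Lw1).
  have := corner_lt_lowered (ltnW wn) Lw1.
  move/and3P: Lw => [_ _ /eqP]; move/and3P: Lw1 => [_ _ /eqP]; rewrite /rect.
  move: Lw'; rewrite /lowered xj rectS /row_strip /rect.
  have := @rect_ge w.+1 x; rewrite rectS /row_strip /rect.
  have := cornerSl cC wn lt_jn; have := cornerSl cC wn (ltnW xn).
  rewrite eik in e1 *; lia.
(* The gap lies in column [j]: it slides west along its row.                   *)
have Lkx : lowered k x by apply: lowered_north => //; lia.
have exj : x = j.
  apply/eqP; apply: contraNT b2 => nxj; apply: lowered_east => //; lia.
rewrite {x}exj in xn g e1 e2 e3 b1 b2 xj Lkx *.
have [w [wj Lw Lw']] := lowered_first kn (leqnn j) b1.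
have Lw1 : lowered k w.+1 by apply: lowered_north => //; lia.
exists k, w; split=> //; [lia|].
rewrite /gap (lower_at_zero Lw') (lower_at_one Lw1).
have := corner_lt_lowered (ltnW kn) Lw1.
move/and3P: Lw => [_ _ /eqP]; move/and3P: Lw1 => [_ _ /eqP].
move/and3P: b1 => [_ _ /eqP]; move/and3P: Lkx => [_ _ /eqP]; rewrite /rect.
have wn : (w < n)%N by lia.
have := cornerSr cC kn wn.
lia.
Qed.

Lemma has_gap_of_lower : has_gap lower -> has_gap C.
Proof.
move=> [k [x [kn xn g]]].
have [e1 e2 e3] := gap_eq corner_lower kn xn g.
have := cornerSl cC kn (ltnW xn).
have := cornerSl cC kn xn.
have := cornerSr cC (ltnW kn) xn.
have := cornerSr cC kn xn.
(* The gap can be new only when [(k, x.+1)] is lowered and [(k.+1, x)] is not. *)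
have [b1|b1] := boolP (lowered k x.+1); last first.
  move=> h1 h2 h3 h4; exists k, x; split=> //; move: g h1 h2 h3 h4.
  by move: e1 e2 e3; rewrite /gap /lower (negbTE b1); lia.
have ltk := corner_lt_lowered (ltnW kn) b1.
have [b2|b2] := boolP (lowered k.+1 x).
  move=> h1 h2 h3 h4; exists k, x; split=> //; move: g h1 h2 h3 h4.
  by move: e1 e2 e3; rewrite /gap /lower b1 b2; lia.
have /and3P[ik xj /eqP r1] := b1.
have [f1 f2 f3] := neg_at.
have [b3|b3] := boolP (lowered k x).
  (* The strip of column [x] from row [i] to row [k] sums to 0, so the gap slides north to row
     [i]. *)
  have L0 : lowered i.+1 x by apply: lowered_north_trans b3; lia.
  move=> _ _ _ _; exists i, x; split=> //.
  have := @corner_ler C i x.+1 j cC; have := @corner_le C i j.+1 cC.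
  move/and3P: L0 => [_ _ /eqP]; move/and3P: (b3) => [_ _ /eqP].
  move: e1; rewrite /lower b1 b3 /gap; move: r1; rewrite /rect; lia.
move=> h1 h2 h3 h4.
have [b4|b4] := boolP (lowered k.+1 x.+1).
  (* Here the strip of row [k] from column [x.+1] to column [j] sums to 0, and the gap slides east
     to column [j]. *)
  have Lj : lowered k j by apply: lowered_east_trans b1; lia.
  have Lj1 : lowered k.+1 j by apply: lowered_east_trans b4; lia.
  exists k, j; split=> //.
  have := corner_lt_lowered (ltnW kn) Lj.
  move/and3P: Lj => [_ _ /eqP]; move/and3P: Lj1 => [_ _ /eqP].
  move/and3P: (b4) => [_ _ /eqP]; move: r1 e1 e2 e3.
  rewrite /lower b1 (negbTE b2) (negbTE b3) b4 /rect /gap; lia.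
(* Here the entry at [(k, x)] would be a second [-1].                          *)
have := @nonneg_SW k x; rewrite /mixed_diff; move: e1 e2 e3.
by rewrite /lower b1 (negbTE b2) (negbTE b3) (negbTE b4); lia.
Qed.

End Removal.

End CornerFunctions.

(** * Corner sums of matrices *)

Section PartialSums.

Variable n : nat.
Implicit Types (f g : 'I_n -> int) (v w : nat).

Definition psum f v : int := \sum_(l < n | (l < v)%N) f l.

Lemma psum0 f : psum f 0 = 0.
Proof. by rewrite /psum big_pred0. Qed.

Lemma psumn f : psum f n = \sum_l f l.
Proof. by apply: eq_bigl => l; rewrite ltn_ord. Qed.

Lemma psumS f (l : 'I_n) : psum f l.+1 = psum f l + f l.
Proof.
rewrite /psum (bigD1 l) ?ltnS //= addrC; congr (_ + _).
by apply: eq_bigl => k; rewrite ltnS [RHS]ltn_neqAle andbC.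
Qed.

Lemma eq_psum f g v : f =1 g -> psum f v = psum g v.
Proof. by move=> fg; apply: eq_bigr => l _; apply: fg. Qed.

Lemma psumD f g v : psum (fun l => f l + g l) v = psum f v + psum g v.
Proof. exact: big_split. Qed.

Lemma psum_delta (c : 'I_n) (a : int) v :
  psum (fun l => if l == c then a else 0) v = if (c < v)%N then a else 0.
Proof.
rewrite /psum -big_mkcondr; case: ifPn => cv.
  rewrite (big_pred1 c) // => l; rewrite andb_idl // => /eqP -> //.
by rewrite big_pred0 // => l; apply: contraNF cv => /andP[lv /eqP <-].
Qed.

(** Consecutive nonzero entries cancel in pairs, so an interval sums to 0 or to its last nonzero
    entry. *)
Lemma alternating_interval f v w :
  (forall l, f l \in [:: 0; 1; -1]) -> alternating f -> (v <= w <= n)%N ->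
  (psum f w = psum f v /\ forall l : 'I_n, (v <= l < w)%N -> f l = 0) \/
  exists l : 'I_n, [/\ (v <= l < w)%N, f l != 0,
    forall k : 'I_n, (l < k < w)%N -> f k = 0 &
    psum f w = psum f v \/ psum f w = psum f v + f l].
Proof.
move=> f01 alt /andP[]; elim: w => [|w IHw] vw wn.
  have -> : v = 0%N by lia.
  by left; split=> // l; lia.
have [->|vw'] : v = w.+1 \/ (v <= w)%N by lia.
  by left; split=> // l; lia.
pose o := Ordinal wn; have oE : w.+1 = (o : nat).+1 by [].
have So : psum f w.+1 = psum f w + f o := psumS f o.
have [f0|fn0] := eqVneq (f o) 0.
  have f0' (k : 'I_n) : (k : nat) = w -> f k = 0.
    by move=> kw; rewrite -f0; congr f; apply: val_inj.
  case: (IHw vw' (ltnW wn)) => [[e z]|[l [vl lne z e]]].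
    left; rewrite So f0 addr0; split=> // k /andP[vk].
    rewrite ltnS leq_eqVlt => /orP[/eqP/f0'//|kw]; apply: z; exact/andP.
  right; exists l; split=> //; [by lia| |by rewrite So f0 addr0].
  move=> k /andP[lk]; rewrite ltnS leq_eqVlt => /orP[/eqP/f0'//|kw].
  by apply: z; exact/andP.
right; exists o; split=> //; [by rewrite /=; lia|by rewrite /= => k; lia|].
case: (IHw vw' (ltnW wn)) => [[e z]|[l [vl lne z e]]].
  by right; rewrite So e.
have lo : (l < o)%N by rewrite /=; lia.
have := alt l o lo lne fn0 z; rewrite So.
have := f01 o; have := f01 l; rewrite !inE.
by case/or3P=> /eqP e1; case/or3P=> /eqP e2; move: lne fn0 e; rewrite e1 e2 //=;
   rewrite ?sgr1 ?sgrN1 ?sgrN; lia.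
Qed.

(** A prefix and the complementary suffix each sum to at most 1 in absolute value and together to 1,
    so a prefix sum of [-1] would need a suffix sum of 2. *)
Lemma alternating_psum f v :
  (forall l, f l \in [:: 0; 1; -1]) -> alternating f -> \sum_l f l = 1 ->
  (v <= n)%N -> 0 <= psum f v <= 1.
Proof.
move=> f01 alt; rewrite -psumn => sum1 vn.
have h1 : (0 <= v <= n)%N by [].
have h2 : (v <= n <= n)%N by rewrite vn leqnn.
have bound l : -1 <= f l <= 1 by have := f01 l; rewrite !inE => /or3P[]/eqP ->.
case: (alternating_interval f01 alt h1) (alternating_interval f01 alt h2).
  move=> [e1 _] [[e2 _]|[l [_ _ _ e2]]]; move: e1 e2; rewrite psum0 sum1; last by lia.
  by lia.
move=> [l [_ _ _ e1]] [[e2 _]|[k [_ _ _ e2]]]; move: e1 e2; rewrite psum0 sum1.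
  by lia.
by have := bound l; have := bound k; lia.
Qed.

Lemma psum_alternating f :
  (forall v, (v <= n)%N -> 0 <= psum f v <= 1) -> alternating f.
Proof.
move=> b j1 j2 j12 n1 n2 z.
have e w : (j1 < w <= j2)%N -> psum f w = psum f j1.+1.
  elim: w => [|w IHw] //; rewrite ltnS => /andP[jw wj].
  have [<-//|jw'] : (j1 : nat) = w \/ (j1 < w)%N by lia.
  have wn : (w < n)%N by have := ltn_ord j2; lia.
  have -> : psum f w.+1 = psum f w + f (Ordinal wn) by exact: (psumS f (Ordinal wn)).
  by rewrite z ?addr0 /= ?IHw; lia.
have := e j2; rewrite j12 leqnn => /(_ isT).
have := b j2 (ltnW (ltn_ord j2)); have := b j2.+1 (ltn_ord j2).
have := b j1 (ltnW (ltn_ord j1)); have := b j1.+1 (ltn_ord j1).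
rewrite !psumS => h1 h2 h3 h4 h5.
have [e1|e1] : f j1 = 1 \/ f j1 = -1 by lia.
  have -> : f j2 = -1 by lia.
  by rewrite e1.
have -> : f j2 = 1 by lia.
by rewrite e1.
Qed.

End PartialSums.

(** * Alternating sign matrices as corner functions *)

Section CornerSums.

Variable n : nat.
Implicit Types (A : 'M[int]_n) (u v : nat).

Definition csum A u v : int := psum (fun k => psum (A k) v) u.

Lemma csum_exchange A u v : csum A u v = psum (fun l => psum (A^~ l) u) v.
Proof. by rewrite /csum /psum exchange_big. Qed.

Lemma csumSl A (k : 'I_n) v : csum A k.+1 v = csum A k v + psum (A k) v.
Proof. exact: psumS. Qed.

Lemma csumSr A u (l : 'I_n) : csum A u l.+1 = csum A u l + psum (A^~ l) u.
Proof. by rewrite !csum_exchange psumS. Qed.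

Lemma csum0l A v : csum A 0 v = 0.
Proof. exact: psum0. Qed.

Lemma csum0r A u : csum A u 0 = 0.
Proof. by rewrite csum_exchange psum0. Qed.

Lemma csum_diff A (k l : 'I_n) : mixed_diff (csum A) k l = A k l.
Proof. by rewrite /mixed_diff !csumSl !psumS; lia. Qed.

Lemma csum_inj A A' :
  (forall u v, (u <= n)%N -> (v <= n)%N -> csum A u v = csum A' u v) -> A = A'.
Proof.
move=> e; apply/matrixP => k l; rewrite -!csum_diff /mixed_diff.
by rewrite !e ?ltn_ord // ltnW.
Qed.

Lemma psum_const1 v : (v <= n)%N -> psum (fun _ : 'I_n => 1) v = v%:Z.
Proof.
elim: v => [|v IHv] vn; first by rewrite psum0.
by have := psumS (fun _ : 'I_n => 1) (Ordinal vn) => /= ->; rewrite IHv ?(ltnW vn) //; lia.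
Qed.

Lemma asm_corner A : is_asm A -> corner n (csum A).
Proof.
case=> e01 rs cs ralt calt; split.
- by move=> v _; rewrite csum0l.
- by move=> u _; rewrite csum0r.
- move=> v vn; rewrite csum_exchange -psum_const1 //.
  by apply: eq_psum => l; rewrite psumn cs.
- by move=> u un; rewrite -psum_const1 //; apply: eq_psum => k; rewrite psumn rs.
- move=> u v un vn; rewrite (csumSl A (Ordinal un)).
  have := alternating_psum (e01 (Ordinal un)) (ralt _) (rs _) vn.
  by rewrite /=; lia.
- move=> u v un vn; rewrite (csumSr A u (Ordinal vn)).
  have := alternating_psum (e01^~ (Ordinal vn)) (calt _) (cs _) un.
  by rewrite /=; lia.
Qed.

Lemma corner_asm A : corner n (csum A) -> is_asm A.
Proof.
move=> cC.
have row k v : (v <= n)%N -> 0 <= psum (A k) v <= 1.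
  by move=> vn; have := cornerSl cC (ltn_ord k) vn; rewrite csumSl; lia.
have col l u : (u <= n)%N -> 0 <= psum (A^~ l) u <= 1.
  by move=> un; have := cornerSr cC un (ltn_ord l); rewrite csumSr; lia.
split.
- move=> k l; have := row k _ (ltn_ord l); have := row k _ (ltnW (ltn_ord l)).
  by rewrite psumS !inE; lia.
- move=> k; have := cornernr cC (ltn_ord k); rewrite csumSl -(psumn (A k)).
  by rewrite (cornernr cC (ltnW (ltn_ord k))); lia.
- move=> l; have := cornernl cC (ltn_ord l); rewrite csumSr -(psumn (A^~ l)).
  by rewrite (cornernl cC (ltnW (ltn_ord l))); lia.
- by move=> k; apply: psum_alternating => v; exact: row.
- by move=> l; apply: psum_alternating => u; exact: col.
Qed.

Definition matrix_of_corner (C : nat -> nat -> int) : 'M[int]_n :=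
  \matrix_(k, l) mixed_diff C k l.

Lemma csum_matrix_of_corner C u v : corner n C -> (u <= n)%N -> (v <= n)%N ->
  csum (matrix_of_corner C) u v = C u v.
Proof.
move=> cC; elim: u v => [|u IHu] v un vn; first by rewrite csum0l (corner0l cC).
elim: v vn => [|v IHv] vn; first by rewrite csum0r (corner0r cC).
have := csum_diff (matrix_of_corner C) (Ordinal un) (Ordinal vn).
rewrite mxE /= /mixed_diff (IHu v.+1) ?(ltnW un) // (IHu v) ?(ltnW un) ?(ltnW vn) //.
by rewrite IHv ?(ltnW vn) //; lia.
Qed.

Lemma csum_set_entry A (r c : 'I_n) a u v :
  csum (set_entry A r c a) u v =
  csum A u v + (if (r < u)%N && (c < v)%N then a - A r c else 0).
Proof.
transitivity (csum A u v +
  psum (fun k => if k == r then (if (c < v)%N then a - A r c else 0) else 0) u).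
  rewrite -psumD; apply: eq_psum => k.
  rewrite -psum_delta; have [->|kr] := eqVneq k r.
    rewrite -psumD; apply: eq_psum => l; rewrite mxE eqxx /=.
    by case: eqP => [->|_]; rewrite ?addr0 // addrC subrK.
  by rewrite addr0; apply: eq_psum => l; rewrite mxE (negbTE kr).
by rewrite psum_delta; case: (_ < u)%N.
Qed.

End CornerSums.

(** * One removal *)

Section Step.

Variable n : nat.
Implicit Types (A : 'M[int]_n) (u v : nat) (p q : 'I_n * 'I_n).

(** Despite the name, [p] is southeast of [q]: the moved [1]s, listed from east to west, run from
    southeast to northwest. *)
Definition strictly_SW p q : bool := (q.1 < p.1)%N && (q.2 < p.2)%N.

Lemma shift_ones_other A (r : 'I_n) s (k l : 'I_n) :
  (forall p, p \in s -> p.2 != l) -> shift_ones A r s k l = A k l.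
Proof.
elim: s A r => [//|[r' c] s IHs] A r ne /=.
have cl : c != l by apply: (ne (r', c)); rewrite mem_head.
rewrite IHs => [|p ps]; last by apply: ne; rewrite in_cons ps orbT.
by rewrite !mxE ![l == c]eq_sym (negbTE cl) !andbF.
Qed.

(** Lowering the [1] of column [c] from row [r'] to row [r] costs 1 at the corners with
    [r' < u <= r] and [c < v]. The row ranges of successive moves are disjoint, so at most one move
    matters for a given [u]: that of the first [p] of [s] with [p.1 < u], which is also the
    east-most such [p]. *)
Lemma csum_shift_ones A (r : 'I_n) s u v :
  pairwise strictly_SW s -> (forall p, p \in s -> (p.1 < r)%N) ->
  (forall p, p \in s -> A p.1 p.2 = 1) ->
  (forall p (k : 'I_n), p \in s -> (p.1 < k)%N -> A k p.2 = 0) ->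
  csum (shift_ones A r s) u v = csum A u v -
    (if [&& (u <= r)%N, has (fun p => p.1 < u)%N s
          & all (fun p => (p.1 < u)%N ==> (p.2 < v)%N) s] then 1 else 0).
Proof.
elim: s A r => [|[r' c] s IHs] A r; first by rewrite /= andbF subr0.
rewrite pairwise_cons => /andP[/allP sw pw] rows ones zeros /=.
have r'r : (r' < r)%N by apply: (rows (r', c)); rewrite mem_head.
have c_lt p : p \in s -> (p.2 < c)%N by move=> /sw /andP[].
have neqc p : p \in s -> (p.2 == c) = false.
  by move=> /c_lt; rewrite ltn_neqAle => /andP[/negbTE].
rewrite IHs //.
- have A1 : A r' c = 1 := ones (r', c) (mem_head _ _).
  have A0 : A r c = 0 := zeros (r', c) r (mem_head _ _) r'r.
  have ne : (r' == r) = false by apply/negbTE; rewrite neq_ltn r'r.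
  rewrite !csum_set_entry !mxE ne /= A1 A0.
  have [ru|ru] := leqP u r; have [r'u|r'u] := ltnP r' u;
    have [cv|cv] := ltnP c v => //=; try lia.
  have -> : all (fun p => (p.1 < u)%N ==> (p.2 < v)%N) s by
    apply/allP => p /c_lt pc; apply/implyP => _; lia.
  by lia.
- by move=> p /sw /andP[].
- move=> p ps; rewrite !mxE (neqc p ps) !andbF.
  by apply: ones; rewrite in_cons ps orbT.
- move=> p k ps pk; rewrite !mxE (neqc p ps) !andbF.
  by apply: zeros => //; rewrite in_cons ps orbT.
Qed.

Section Removal.

Variables (A : 'M[int]_n) (i j i0 j0 : 'I_n).
Hypotheses (asmA : is_asm A) (rem_ij : removable A (i, j)).
Hypotheses (west : nearest_west_one A i j j0) (south : nearest_south_one A i j i0).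

Let S := moved_ones A i j i0 j0.

Lemma removable_neg : mixed_diff (csum A) i j = -1.
Proof. by rewrite csum_diff; case: rem_ij. Qed.

Lemma removable_nonneg (k l : 'I_n) : (i <= k)%N -> (l <= j)%N ->
  (k, l) != (i, j) -> 0 <= A k l.
Proof.
move=> ik lj ne; case: asmA => e01 _ _ _ _.
have := e01 k l; rewrite !inE => /or3P[/eqP->|/eqP->|/eqP e] //.
case: rem_ij => _ /(_ (k, l) e); rewrite /weakly_SW /= ik lj => /(_ isT) eq.
by rewrite eq eqxx in ne.
Qed.

Lemma removable_nonneg_SW u v : (i <= u < n)%N -> (v <= j)%N ->
  (u != i) || (v != j) -> 0 <= mixed_diff (csum A) u v.
Proof.
move=> /andP[iu un] vj ne; have vn := leq_ltn_trans vj (ltn_ord j).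
rewrite (csum_diff A (Ordinal un) (Ordinal vn)).
apply: removable_nonneg => //; rewrite xpair_eqE negb_and; exact: ne.
Qed.

Lemma moved_neighboring p : p \in S ->
  [/\ neighboring A (i, j) p, (i <= p.1 <= i0)%N & (j0 <= p.2 <= j)%N].
Proof.
case: west => j0j Aj0 nw; case: south => ii0 Ai0 ns.
have [Aij _] := rem_ij; rewrite /= in Aij.
rewrite inE => /or3P[/eqP->|/eqP->|/and3P[]//].
- rewrite leqnn (ltnW ii0) leqnn (ltnW j0j); split=> //.
  rewrite /neighboring /= Aj0 eqxx /weakly_SW /= leqnn (ltnW j0j) /=.
  apply/forallP => -[k l]; apply/implyP => /=.
  case/and3P=> /eqP Akl /andP[ki j0l] /andP[ik lj].
  have e : k = i by apply/val_inj/anti_leq; rewrite ki ik.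
  subst k; rewrite xpair_eqE eqxx /=; apply/eqP/val_inj/eqP.
  rewrite /= eqn_leq j0l andbT leqNgt; apply/negP => j0l'.
  have [lj'|jl] := ltnP l j; first by apply: (nw l) => //; rewrite j0l'.
  have e : l = j by apply/val_inj/anti_leq; rewrite lj jl.
  by move: Akl; rewrite e Aij.
- rewrite leqnn (ltnW ii0) leqnn (ltnW j0j); split=> //.
  rewrite /neighboring /= Ai0 eqxx /weakly_SW /= leqnn (ltnW ii0) /=.
  apply/forallP => -[k l]; apply/implyP => /=.
  case/and3P=> /eqP Akl /andP[ki j0l] /andP[ik lj].
  have e : l = j by apply/val_inj/anti_leq; rewrite lj j0l.
  subst l; rewrite xpair_eqE eqxx andbT /=; apply/eqP/val_inj/eqP.
  rewrite /= eqn_leq ki /= leqNgt; apply/negP => ki'.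
  have [ik'|ki''] := ltnP i k; first by apply: (ns k) => //; rewrite ik'.
  have e : k = i by apply/val_inj/anti_leq; rewrite ik ki''.
  by move: Akl; rewrite e Aij.
Qed.

Lemma moved_one p : p \in S -> A p.1 p.2 = 1.
Proof. by case/moved_neighboring => /and3P[/eqP]. Qed.

Lemma moved_antichain p q : p \in S -> q \in S -> p != q -> (q.2 <= p.2)%N ->
  strictly_SW p q.
Proof.
move=> pS qS npq qp; have [np pr pc] := moved_neighboring pS.
have [nq qr qc] := moved_neighboring qS.
have Hp : weakly_SW p q -> q == p.
  move=> pq; have /and3P[_ _ /forallP/(_ q)/implyP] := np; apply.
  by rewrite pq; case/and3P: nq => -> ->.
have Hq : weakly_SW q p -> p == q.
  move=> qp'; have /and3P[_ _ /forallP/(_ p)/implyP] := nq; apply.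
  by rewrite qp'; case/and3P: np => -> ->.
move: Hp Hq npq; rewrite [q == p]eq_sym /weakly_SW /strictly_SW.
by case: (p == q) => //; lia.
Qed.

(** Below a moved [1] the column has no negative entry, and its prefix sum is already 1 there. *)
Lemma moved_below_zero p (k : 'I_n) : p \in S -> (p.1 < k)%N -> A k p.2 = 0.
Proof.
move=> pS pk; have [np /andP[ip pi0] /andP[j0p pj]] := moved_neighboring pS.
have nonneg (m : 'I_n) : (p.1 < m)%N -> 0 <= A m p.2.
  move=> pm; apply: removable_nonneg => //; first by lia.
  by rewrite xpair_eqE; apply/negP => /andP[/eqP e _]; move: pm; rewrite e; lia.
case: asmA => e01 _ cs _ calt.
have b u : (u <= n)%N -> 0 <= psum (A^~ p.2) u <= 1.
  by apply: alternating_psum (calt _) (cs _) => m; exact: e01.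
have mono u : (p.1 < u <= n)%N -> psum (A^~ p.2) p.1.+1 <= psum (A^~ p.2) u.
  elim: u => [|u IHu] //; rewrite ltnS => /andP[pu un].
  have [<-//|pu'] : (p.1 : nat) = u \/ (p.1 < u)%N by lia.
  rewrite (psumS _ (Ordinal un)) /=.
  have := nonneg (Ordinal un) pu'; have := IHu; lia.
have k1 := mono k; have := b k.+1 (ltn_ord k); have := b p.1 (ltnW (ltn_ord p.1)).
move: k1; rewrite !psumS (moved_one pS); have := nonneg k pk.
have := ltn_ord k; lia.
Qed.

(** Take the [1] furthest to the northeast, in the sense of [p.2 + (n - p.1)], among those between
    [q] and the [-1]. *)
Lemma neighboring_above q : A q.1 q.2 = 1 -> weakly_SW q (i, j) ->
  exists2 p, neighboring A (i, j) p & weakly_SW q p.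
Proof.
move=> Aq qm.
pose P p := [&& A p.1 p.2 == 1, weakly_SW q p & weakly_SW p (i, j)].
have Pq : P q by rewrite /P Aq eqxx qm /weakly_SW !leqnn.
case: (@arg_maxnP _ q P (fun p => p.2 + (n - p.1))%N Pq).
case=> p1 p2 /and3P[Ap qp pm] pmax.
exists (p1, p2) => //; rewrite /neighboring Ap pm /=; apply/forallP => -[t1 t2].
apply/implyP => /and3P[At pt tm].
have Pt : P (t1, t2).
  by rewrite /P At tm andbT /=; move: qp pt; rewrite /weakly_SW /=; lia.
have := pmax _ Pt; move: pt; rewrite /weakly_SW => /andP[/= tp1 tp2] /= le.
have ltn1 := ltn_ord t1; have ltn2 := ltn_ord p1.
by rewrite xpair_eqE; apply/andP; split; apply/eqP/val_inj => /=; lia.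
Qed.

Lemma csum_remove_neg u v : (u <= n)%N -> (v <= n)%N ->
  csum (remove_neg A i j i0 j0) u v = lower (csum A) i j u v.
Proof.
move=> un vn; rewrite /remove_neg -/S.
set s := sort _ _.
have j0j : (j0 < j)%N by case: west.
have ii0 : (i < i0)%N by case: south.
have Aij : A i j = -1 by case: rem_ij.
have tot : total (fun p q : 'I_n * 'I_n => (q.2 <= p.2)%N) by move=> p q; exact: leq_total.
have memS p : p \in s = (p \in S) by rewrite mem_sort mem_enum.
have pw : pairwise strictly_SW s.
  have tr : transitive (fun p q : 'I_n * 'I_n => (q.2 <= p.2)%N).
    by move=> p q t qp tp; apply: leq_trans tp qp.
  have h1 := sort_sorted tot (enum S); rewrite (sorted_pairwise tr) -/s in h1.
  have h2 : uniq s by rewrite sort_uniq enum_uniq.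
  rewrite uniq_pairwise in h2.
  have h3 : all (fun p => p \in S) s by apply/allP => p; rewrite memS.
  have := pairwise_relI (fun p q : 'I_n * 'I_n => (q.2 <= p.2)%N)
            [rel p q | p != q] s.
  rewrite h1 h2 /= => h4.
  apply: (sub_in_pairwise _ h3) h4 => p q pS qS /= /andP[qp npq].
  exact: moved_antichain.
have inS1 : (i0, j) \in S by rewrite inE eqxx orbT.
have inS2 : (i, j0) \in S by rewrite inE eqxx.
case es : s => [|[r c] s']; first by move: inS1; rewrite -memS es.
move: pw; rewrite es pairwise_cons => /andP[/allP hd pw].
have sS p : p \in (r, c) :: s' -> p \in S by rewrite -memS es.
(* Columns strictly decrease along the list and none exceeds [j]. *)
have hrc : (r, c) = (i0, j).
  have := memS (i0, j); rewrite inS1 es in_cons => /orP[/eqP//|/hd /andP[_ /=]].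
  have [_ _ /andP[_ /=]] := moved_neighboring (sS _ (mem_head _ _)); lia.
case: hrc => er ec; rewrite {r}er {c}ec in es hd sS *.
have s'S p : p \in s' -> p \in S by move=> ps; apply: sS; rewrite in_cons ps orbT.
have s'lt p : p \in s' -> (p.1 < i0)%N && (p.2 < j)%N by move/hd.
have nej p : p \in s' -> (p.2 == j) = false.
  by move=> /s'lt/andP[_]; rewrite ltn_neqAle => /andP[/negbTE].
rewrite csum_set_entry shift_ones_other => [|p /nej ->//].
rewrite csum_shift_ones //.
- rewrite csum_set_entry !mxE eqxx andbT Aij (moved_one inS1).
  have -> : (i == i0) = false by apply/negbTE; rewrite neq_ltn ii0.
  have ins' : (i, j0) \in s'.
    move: inS2; rewrite -memS es in_cons xpair_eqE.
    by have -> : (i == i0) = false by apply/negbTE; rewrite neq_ltn ii0.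
  have [iu|ui] := ltnP i u; last first.
    have -> : has (fun p => (p.1 < u)%N) s' = false.
      apply/negP => /hasP[p /s'S/moved_neighboring[_ /andP[ip _] _] pu].
      by have := leq_ltn_trans ip pu; rewrite ltnNge ui.
    rewrite /lower /lowered !ltnNge ui (leq_trans ui (ltnW ii0)) /= ?andbF /=.
    by lia.
  have -> : has (fun p => (p.1 < u)%N) s' by apply/hasP; exists (i, j0).
  (* East of column [j] the changes cancel: erasing the [-1] offsets the shift when [u <= i0], and
     the erased [1] at [(i0, j)] when [i0 < u]. For [v <= j] only the shift counts. *)
  have [jv|vj] := ltnP j v.
    have -> : all (fun p => (p.1 < u)%N ==> (p.2 < v)%N) s'.
      apply/allP => p /s'lt /andP[_ pj]; apply/implyP => _; lia.
    by rewrite /lower /lowered (leqNgt v j) jv ?andbF ?andbT /=; case: ltnP; lia.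
  rewrite /= /lower /lowered iu vj /= andbF.
  suff -> : (rect (csum A) i j u v == -1) =
    (u <= i0)%N && all (fun p => (p.1 < u)%N ==> (p.2 < v)%N) s'.
    by case: ifP; lia.
  have negij := removable_neg; have nn := removable_nonneg_SW.
  have one p : p \in S -> (p.1 < u)%N -> (v <= p.2)%N ->
      rect (csum A) i j u v != -1.
    move=> pS pu vp; have [_ /andP[ip _] /andP[_ pj]] := moved_neighboring pS.
    have := @rect_one n (csum A) i j (ltn_ord i) (ltn_ord j) negij nn u v p.1 p.2.
    by rewrite csum_diff (moved_one pS); lia.
  apply/idP/idP => [/eqP r|/andP[ui0 /allP al]].
    apply/andP; split.
      rewrite leqNgt; apply/negP => i0u.
      by have := one _ inS1 i0u vj; rewrite r eqxx.
    apply/allP => p /s'S pS; apply/implyP => pu; rewrite ltnNge; apply/negP => vp.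
    by have := one _ pS pu vp; rewrite r eqxx.
  have iun : (i < u <= n)%N by rewrite iu.
  have := @rect_ge n (csum A) i j (ltn_ord i) (ltn_ord j) negij nn u v iun vj.
  apply: contraLR => nr; apply/negP => rge.
  have r0 : 0 <= rect (csum A) i j u v by lia.
  have [k [l [/andP[ik ku] /andP[vl lj] pos]]] :=
    @one_of_rect n (csum A) i j (ltn_ord i) (ltn_ord j) negij u v iun vj r0.
  have kn : (k < n)%N by lia.
  have ln : (l < n)%N by have := ltn_ord j; lia.
  pose q := (Ordinal kn, Ordinal ln).
  have Aq : A q.1 q.2 = 1.
    rewrite (csum_diff A (Ordinal kn) (Ordinal ln)) in pos.
    case: asmA => e01 _ _ _ _; have := e01 q.1 q.2; rewrite !inE.
    by case/or3P => /eqP // e; move: pos; rewrite e.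
  have qm : weakly_SW q (i, j) by rewrite /weakly_SW /= ik lj.
  (* Since [(i, j0)] is in [s'], [al] gives [j0 < v], so [p] is a moved [1]. Its row is above [i0],
     hence it lies in [s'], and its column is at least [v], against [al]. *)
  have [p np qp] := neighboring_above Aq qm.
  have /andP[ip pj] : weakly_SW p (i, j) by case/and3P: np.
  move: qp; rewrite /weakly_SW /= => /andP[pk lp].
  rewrite /= in ip pj.
  have j0p : (j0 <= p.2)%N.
    by have := al _ ins'; rewrite /= iu /=; lia.
  have pS : p \in S.
    by rewrite inE np ip pj j0p /= andbT; apply/orP; right; apply/orP; right; lia.
  have : p \in s'.
    move: pS; rewrite -memS es in_cons => /orP[/eqP e|//].
    by move: pk; rewrite e /=; lia.
  by move=> /al; lia.
- by move=> p /hd /andP[].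
- by move=> p ps; rewrite mxE nej // andbF moved_one // s'S.
- move=> p k ps pk; rewrite mxE nej // andbF; apply: moved_below_zero => //.
  exact: s'S.
Qed.

End Removal.

End Step.

(** * The SW key *)

Section Key.

Variable n : nat.
Implicit Types (A : 'M[int]_n) (C : nat -> nat -> int) (s : 'S_n).

Lemma eq_corner C C' :
  (forall u v, (u <= n)%N -> (v <= n)%N -> C' u v = C u v) ->
  corner n C -> corner n C'.
Proof.
move=> e cC; split=> [v vn|u un|v vn|u un|u v un vn|u v un vn].
- by rewrite e // (corner0l cC).
- by rewrite e // (corner0r cC).
- by rewrite e // (cornernl cC).
- by rewrite e // (cornernr cC).
- by rewrite !e ?(ltnW un) //; exact: (cornerSl cC un vn).
- by rewrite !e ?(ltnW vn) //; exact: (cornerSr cC un vn).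
Qed.

Lemma eq_has_gap C C' :
  (forall u v, (u <= n)%N -> (v <= n)%N -> C' u v = C u v) ->
  has_gap n C <-> has_gap n C'.
Proof.
by move=> e; split=> -[k [x [kn xn g]]]; exists k, x; split=> //; move: g;
   rewrite /gap !e ?(ltnW kn) ?(ltnW xn).
Qed.

(** Termination measure: corner sums of an ASM are nonnegative, and a removal at [(i, j)] lowers at
    least the one at [(i.+1, j)]. *)
Definition mass A : nat :=
  \sum_(p : 'I_n.+1 * 'I_n.+1) `|csum A p.1 p.2|%N.

Lemma SW_step_inv A A' : is_asm A -> SW_step A A' ->
  [/\ is_asm A', has_gap n (csum A) <-> has_gap n (csum A')
    & (mass A' < mass A)%N].
Proof.
move=> asmA [i [j [i0 [j0 [rem west south ->]]]]].
have cC := asm_corner asmA.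
have e := csum_remove_neg asmA rem west south.
have cneg := removable_neg rem; have nn := removable_nonneg_SW asmA rem.
have ilt := ltn_ord i; have jlt := ltn_ord j.
have cC' := corner_lower cC ilt jlt cneg nn.
split.
- exact/corner_asm/(eq_corner e).
- rewrite -(eq_has_gap e).
  by split; [exact: has_gap_lower|exact: has_gap_of_lower].
- have i1 : (i.+1 < n.+1)%N by [].
  have j1 : (j < n.+1)%N by rewrite ltnW.
  pose p0 : 'I_n.+1 * 'I_n.+1 := (Ordinal i1, Ordinal j1).
  have L := lowered_ij ilt jlt cneg.
  rewrite /mass (bigD1 p0) //= [X in (_ < X)%N](bigD1 p0) //= -addSn leq_add //.
    rewrite e ?(ltnW jlt) //.
    have := corner_le cC' ilt (ltnW jlt).
    by rewrite /lower L; lia.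
  apply: leq_sum => p _; have p1 := ltn_ord p.1; have p2 := ltn_ord p.2.
  rewrite e //; have := corner_le cC' p1 p2; rewrite /lower.
  by case: (lowered _ _ _ _ _); lia.
Qed.

Lemma SW_steps_inv A A' : clos_refl_trans _ (@SW_step n) A A' -> is_asm A ->
  is_asm A' /\ (has_gap n (csum A) <-> has_gap n (csum A')).
Proof.
elim=> {A A'} [A A' st asmA|A asmA|A A' A'' _ IH1 _ IH2 asmA].
- by have [] := SW_step_inv asmA st.
- by [].
have [asmA' g1] := IH1 asmA; have [asmA'' g2] := IH2 asmA'.
by split=> //; rewrite g1 g2.
Qed.

Lemma alternating_last_one (f : 'I_n -> int) (v w : nat) :
  (forall l, f l \in [:: 0; 1; -1]) -> alternating f -> (v <= w <= n)%N ->
  psum f w = psum f v + 1 ->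
  exists l : 'I_n, [/\ (v <= l < w)%N, f l = 1
                     & forall k : 'I_n, (l < k < w)%N -> f k = 0].
Proof.
move=> f01 alt vw e.
case: (alternating_interval f01 alt vw) => [[e' _]|[l [vl _ z [e'|e']]]].
- by lia.
- by lia.
by exists l; split=> //; lia.
Qed.

Lemma SW_step_exists A : is_asm A -> (exists p, A p.1 p.2 = -1) ->
  exists A', SW_step A A'.
Proof.
move=> asmA [p0 /eqP Ap0].
pose P (p : 'I_n * 'I_n) := A p.1 p.2 == -1.
(* Any other [-1] weakly southwest of the minimiser would have a smaller value, so the minimiser is
   removable. *)
case: (@arg_minnP _ p0 P (fun p => p.2 + (n - p.1))%N Ap0) => -[i j] /eqP /= Aij pmin.
have [e01 rs cs ralt calt] := asmA.
have rem : removable A (i, j).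
  split=> // -[k l] /= Akl; rewrite /weakly_SW /= => /andP[ik lj].
  have := pmin (k, l); rewrite /P /= Akl eqxx => /(_ isT) le.
  have ltn1 := ltn_ord i; have ltn2 := ltn_ord k.
  by congr pair; apply: val_inj => /=; lia.
have [j0 [j0j Aj0 z0]] : exists l : 'I_n, [/\ (0 <= l < j)%N, A i l = 1
    & forall k : 'I_n, (l < k < j)%N -> A i k = 0].
  apply: alternating_last_one => //; first exact: (ltnW (ltn_ord j)).
  rewrite psum0; have := alternating_psum (e01 i) (ralt i) (rs i) (ltn_ord j).
  have := alternating_psum (e01 i) (ralt i) (rs i) (ltnW (ltn_ord j)).
  by rewrite psumS Aij; lia.
have [k0 [ik0 Ak0 _]] : exists k : 'I_n, [/\ (i.+1 <= k < n)%N, A k j = 1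
    & forall k' : 'I_n, (k < k' < n)%N -> A k' j = 0].
  apply: (@alternating_last_one (A^~ j)) => //; first by rewrite ltn_ord /=.
  have b u := @alternating_psum n (A^~ j) u (e01^~ j) (calt j) (cs j).
  have := b i.+1 (ltn_ord i); have := b i (ltnW (ltn_ord i)).
  by rewrite psumS Aij psumn cs; lia.
pose Q (k : 'I_n) := (i < k)%N && (A k j == 1).
have Qk0 : Q k0 by rewrite /Q Ak0 eqxx andbT; case/andP: ik0.
case: (@arg_minnP _ k0 Q (fun k => k : nat) Qk0) => i0 /andP[ii0 /eqP Ai0] imin.
exists (remove_neg A i j i0 j0), i, j, i0, j0; split=> //.
- by split=> // l lj; rewrite z0.
- split=> // k /andP[ik ki0] Akj; have := imin k; rewrite /Q ik Akj eqxx => /(_ isT).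
  by rewrite leqNgt ki0.
Qed.

Lemma sum1_unique (f : 'I_n -> int) (a b : 'I_n) :
  (forall l, 0 <= f l) -> \sum_l f l = 1 -> f a = 1 -> f b = 1 -> a = b.
Proof.
move=> f0 s1 fa fb; apply/eqP; apply: contraT => nab.
move: s1; rewrite (bigD1 a) //= (bigD1 b) 1?eq_sym //= fa fb.
set X := \sum_(_ < n | _) _ => s1.
have : 0 <= X by apply: sumr_ge0.
by lia.
Qed.

Lemma asm_perm A : is_asm A -> (forall i j, A i j <> -1) ->
  exists s, A = perm_mx s.
Proof.
case=> e01 rs cs ralt calt nneg.
have pos i j : 0 <= A i j.
  by have := e01 i j; have := nneg i j; rewrite !inE; lia.
have ex i : exists j, A i j == 1.
  have [|j [_ Aij _]] := @alternating_last_one (A i) 0 n (e01 i) (ralt i) (leqnn n).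
    by rewrite psum0 psumn rs.
  by exists j; apply/eqP.
pose f i := xchoose (ex i).
have fP i : A i (f i) = 1 by apply/eqP/(xchooseP (ex i)).
have finj : injective f.
  move=> a b eab; apply: (@sum1_unique (A^~ (f a))) => //.
  by rewrite eab.
exists (perm finj); apply/matrixP => i j; rewrite !mxE permE.
case: eqP => [<-|ne]; first by rewrite fP.
have := nneg i j; have := e01 i j.
rewrite !inE => /or3P[] /eqP // Aij _.
by case: ne; apply: (@sum1_unique (A i)).
Qed.

Lemma SW_key_exists A : is_asm A -> exists s, SW_key A s.
Proof.
have [m] := ubnP (mass A); elim: m A => [//|m IHm] A ltm asmA.
have [/existsP[p /eqP Ap]|/existsPn nA] := boolP [exists p, A p.1 p.2 == -1].
  have [|A' st] := SW_step_exists asmA; first by exists p.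
  have [asmA' _ lt] := SW_step_inv asmA st.
  have [|s ks] := IHm A' _ asmA'; first by apply: leq_trans lt _.
  by exists s; apply: rt_trans ks; exact: rt_step.
have [i j|s ->] := asm_perm asmA; first by apply/eqP/(nA (i, j)).
by exists s; exact: rt_refl.
Qed.

(** * Gaps of permutation matrices and the pattern 312 *)

Lemma psum_perm_row s k v : psum (perm_mx s k) v = if (s k < v)%N then 1 else 0.
Proof.
rewrite -psum_delta; apply: eq_psum => l; rewrite !mxE eq_sym.
by case: eqP.
Qed.

Lemma psum_perm_col s l u :
  psum (fun k => perm_mx s k l) u = if ((s^-1)%g l < u)%N then 1 else 0 :> int.
Proof.
rewrite -psum_delta; apply: eq_psum => k; rewrite !mxE.
by rewrite (canF_eq (permK s)); case: eqP.
Qed.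

Lemma psum_gt0 (g : 'I_n -> int) u : (forall l, 0 <= g l) ->
  0 < psum g u <-> exists2 l : 'I_n, (l < u)%N & 0 < g l.
Proof.
move=> g0; split=> [|[l lu gl]]; last first.
  rewrite /psum (bigD1 l) //=; set X := \sum_(_ < n | _) _.
  have : 0 <= X by apply: sumr_ge0.
  by lia.
have [/existsP[l /andP[lu gl]] _|/existsPn no] := boolP [exists l : 'I_n, (l < u)%N && (0 < g l)].
  by exists l.
rewrite /psum big1 ?ltxx // => l lu.
by have := no l; have := g0 l; rewrite lu; lia.
Qed.

(** The corner sum falls short of [k] by the number of rows above [k] whose [1] lies east of column
    [x]; such a row plays the 3 of the pattern. *)
Lemma csum_perm_lt s (k x : 'I_n) :
  csum (perm_mx s) k x.+1 < k%:Z <-> exists2 a : 'I_n, (a < k)%N & (x < s a)%N.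
Proof.
pose g (a : 'I_n) : int := if (x < s a)%N then 1 else 0.
have g0 a : 0 <= g a by rewrite /g; case: ifP.
have e : k%:Z = csum (perm_mx s) k x.+1 + psum g k.
  rewrite -(psum_const1 (ltnW (ltn_ord k))) /csum -psumD; apply: eq_psum => a.
  by rewrite psum_perm_row /g ltnS; case: leqP.
have [h1 h2] := psum_gt0 k g0.
split=> [lt|[a ak xa]].
  have [|a ak ga] := h1; first by lia.
  by exists a => //; move: ga; rewrite /g; case: ifP.
have := h2; have : exists2 l : 'I_n, (l < k)%N & 0 < g l by exists a; rewrite // /g xa.
by move=> ex /(_ ex); lia.
Qed.

Lemma gap_permE s (k x : 'I_n) : corner n (csum (perm_mx s)) ->
  gap (csum (perm_mx s)) k x <->
  [/\ (s k < x)%N, (k < (s^-1)%g x)%N & exists2 a : 'I_n, (a < k)%N & (x < s a)%N].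
Proof.
move=> cC; split=> [g|[skx kx ex]].
  have [e1 e2 _] := gap_eq cC (ltn_ord k) (ltn_ord x) g.
  have [_ lt] := andP g.
  move: e1 e2; rewrite csumSl csumSr psum_perm_row psum_perm_col.
  case: ltnP => [|kx]; first by lia.
  case: ltnP => [skx|]; last by lia.
  move=> _ _; split=> //; last exact/csum_perm_lt.
  rewrite ltn_neqAle kx andbT; apply/eqP => /val_inj ek.
  by move: skx; rewrite ek permKV ltnn.
rewrite /gap; apply/andP; split; last exact/csum_perm_lt.
rewrite csumSl csumSr psum_perm_row psum_perm_col skx ltnNge (ltnW kx) /=.
by lia.
Qed.

Lemma contains_312 s : contains s [:: 3; 1; 2]%N <->
  exists a b c : 'I_n, [/\ (a < b < c)%N, (s b < s c)%N & (s c < s a)%N].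
Proof.
split=> [[f [finc fpat]]|[a [b [c [/andP[ab bc] sbc sca]]]]].
  pose o k := inord k : 'I_3.
  exists (f (o 0%N)), (f (o 1%N)), (f (o 2%N)); split.
  - by apply/andP; split; apply: finc; rewrite !inordK.
  - by apply/fpat; rewrite !inordK.
  - by apply/fpat; rewrite !inordK.
exists (fun k : 'I_3 => nth a [:: a; b; c] k); split.
  by case=> -[|[|[|//]]] ? [[|[|[|//]]] ?] //= _; apply: ltn_trans bc.
have sba := ltn_trans sbc sca.
have F x y : (x < y)%N -> (y < x)%N = false by lia.
by case=> -[|[|[|//]]] ? [[|[|[|//]]] ?] /=;
   rewrite ?ltnn ?sbc ?sca ?sba ?(F _ _ sbc) ?(F _ _ sca) ?(F _ _ sba).
Qed.

Lemma has_gap_perm s : corner n (csum (perm_mx s)) ->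
  has_gap n (csum (perm_mx s)) <-> contains s [:: 3; 1; 2]%N.
Proof.
move=> cC; rewrite contains_312; split.
  move=> [k [x [kn xn]]] /(gap_permE (Ordinal kn) (Ordinal xn) cC).
  case=> skx kx [a ak xa]; exists a, (Ordinal kn), ((s^-1)%g (Ordinal xn)).
  by rewrite permKV ak kx.
move=> [a [b [c [/andP[ab bc] sbc sca]]]]; exists b, (s c); split=> //.
by apply/gap_permE; rewrite // permK; split=> //; exists a.
Qed.

(** [key_avoids] asks for one run of the process; the existence of a gap is constant along every
    run, and [SW_key_exists] provides a run for the converse. *)
Lemma key_avoids_has_gap A : is_asm A ->
  key_avoids A [:: 3; 1; 2]%N <-> ~ has_gap n (csum A).
Proof.
move=> asmA; split=> [[s [ks av]]|ng].
  have [/asm_corner cC ->] := SW_steps_inv ks asmA.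
  by rewrite has_gap_perm.
have [s ks] := SW_key_exists asmA; exists s; split=> //.
have [/asm_corner cC g] := SW_steps_inv ks asmA.
by rewrite /avoids -has_gap_perm // -g.
Qed.

End Key.

(** * Monotone triangles *)

Lemma nth_le_count (s : seq nat) (c v : nat) : sorted ltn s -> (c < size s)%N ->
  (nth 0%N s c <= v)%N = (c < count (fun y => y <= v)%N s)%N.
Proof.
elim: s c => [//|x s IHs] c; rewrite /= (path_sortedE ltn_trans) => /andP[/allP ltx so].
case: (leqP x v) => xv cs; first by case: c cs => [|c] cs /=; rewrite ?xv // IHs.
have -> : count (fun y => y <= v)%N s = 0%N.
  by apply/eqP; rewrite -leqn0 leqNgt -has_count -all_predC; apply/allP => y /ltx /=; lia.
case: c cs => [|c] /= cs; first by lia.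
by have := ltx _ (mem_nth 0%N cs); rewrite /=; lia.
Qed.

Section Triangles.

Variable n : nat.
Implicit Types (A : 'M[int]_n) (t : seq (seq nat)) (C : nat -> nat -> int).

Definition triangle_rows t : Prop :=
  size t = n /\ forall i, (i < n)%N ->
    size (nth [::] t i) = i.+1 /\ sorted ltn (nth [::] t i).

(** Row [u.-1] of [t_A] lists, counted from 1, the columns whose first [u] entries sum to 1; those
    at most [v] are counted by the corner sum of [A] at [(u, v)]. *)
Definition corner_of t (u v : nat) : int :=
  if u is i.+1 then (count (fun y => y <= v)%N (nth [::] t i))%:Z else 0.

Lemma entry_le t i c v : triangle_rows t -> (c <= i < n)%N ->
  (entry t i c <= v)%N = (c%:Z < corner_of t i.+1 v).
Proof.
move=> [_ /(_ i) rows] /andP[ci lt_in]; have [sz so] := rows lt_in.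
by rewrite /entry nth_le_count ?sz //=; lia.
Qed.

Lemma corner_of_bound t i v : triangle_rows t -> (i < n)%N ->
  0 <= corner_of t i.+1 v <= (i.+1)%:Z.
Proof.
move=> [_ /(_ i) rows] lt_in; have [sz _] := rows lt_in.
by have := count_size (fun y => y <= v)%N (nth [::] t i); rewrite sz /=; lia.
Qed.

Lemma gapless_has_gap t : triangle_rows t -> corner n (corner_of t) ->
  gapless n t <-> ~ has_gap n (corner_of t).
Proof.
move=> tr cC; have eE := entry_le _ tr.
have mono i i' c : (c <= i <= i')%N -> (i' < n)%N -> (entry t i' c <= entry t i c)%N.
  move=> /andP[ci ii']; elim: i' ii' => [|i' IHi] ii' lt_n.
    by have -> : i = 0%N by lia.
  have [->//|ii''] : i = i'.+1 \/ (i <= i')%N by lia.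
  apply: leq_trans (IHi ii'' (ltnW lt_n)).
  have ci' : (c <= i'.+1 < n)%N by lia.
  have ci'' : (c <= i' < n)%N by lia.
  rewrite eE //; have := eE i' c (entry t i' c) ci''; rewrite leqnn.
  have le_n : (entry t i' c <= n)%N by rewrite eE // (cornernr cC); lia.
  by have := cornerSl cC lt_n le_n; lia.
split=> [gl [k [x [kn xn /andP[g1 g2]]]]|ng c i1 i2 v ci1 ci2 /andP[le1 le2]].
  case: k => [|k] in kn g1 g2; first by rewrite (corner0l cC) in g2.
  have b := corner_of_bound x.+1 tr (ltnW kn).
  pose c := `|corner_of t k.+1 x.+1|%N; have cE : c%:Z = corner_of t k.+1 x.+1.
    by rewrite /c; lia.
  have ck : (c <= k < n)%N by lia.
  have ck' : (c <= k.+1 < n)%N by lia.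
  (* Column [c] exceeds [x.+1] in row [k] and is at most [x] in the next row, so by monotonicity it
     never takes the value [x.+1]. *)
  have h1 := eE k c x.+1 ck; have h2 := eE k.+1 c x ck'.
  have [|i ci e] := gl c k.+1 k x.+1 ck' ck; first by lia.
  have [ik|ki] := leqP i k; first by have := mono i k c; lia.
  by have := mono k.+1 i c; lia.
have [m] := ubnP (n - i2)%N; elim: m i2 ci2 le2 => [//|m IHm] i2 ci2 le2 ltm.
have [e|ne] := eqVneq (entry t i2 c) v; first by exists i2.
have vlt : (v < entry t i2 c)%N by lia.
have [ei|lt_n] : i2.+1 = n \/ (i2.+1 < n)%N by lia.
  have ii : (c <= i1 <= i2)%N by lia.
  by have := mono _ _ _ ii; lia.
have [le3|lt3] := leqP v (entry t i2.+1 c).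
  by apply: (IHm i2.+1); lia.
(* Column [c] drops from above [v] in row [i2] to below [v] in row [i2.+1]. The value [v], counted
   from 1, is matrix column [v.-1], and the first [i2.+1] matrix rows give triangle row [i2]. *)
case: ng; exists i2.+1, v.-1; split=> //.
  have : (entry t i2 c <= n)%N by rewrite eE // (cornernr cC); lia.
  by lia.
have v0 : v.-1.+1 = v by lia.
rewrite /gap v0.
have ci3 : (c <= i2.+1 < n)%N by lia.
have := eE i2 c v ci2; have := eE i2.+1 c v.-1 ci3.
by lia.
Qed.

Definition asm_row A (i : 'I_n) : seq nat :=
  [seq (nat_of_ord j).+1 | j <- enum 'I_n & col_partial_sum A i j == 1].

Lemma nth_triangle_of A (i : 'I_n) : nth [::] (triangle_of A) i = asm_row A i.
Proof. by rewrite (nth_map i) ?nth_ord_enum // size_enum_ord. Qed.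

Lemma asm_row_sorted A i : sorted ltn (asm_row A i).
Proof.
rewrite /asm_row sorted_map.
apply: (@sorted_filter _ (relpre (fun j : 'I_n => j.+1) ltn)).
  by move=> a b c /=; lia.
rewrite -(@sorted_map _ _ (fun j : 'I_n => j.+1)).
have -> : [seq (nat_of_ord j).+1 | j <- enum 'I_n] = iota 1 n.
  by rewrite (iotaDl 1 0) -val_enum_ord -map_comp.
exact: iota_ltn_sorted.
Qed.

Lemma csum_asm_row A (i : 'I_n) v : is_asm A ->
  csum A i.+1 v = (count (fun y => y <= v)%N (asm_row A i))%:Z.
Proof.
case=> e01 _ cs _ calt; rewrite csum_exchange /asm_row count_map count_filter.
rewrite -sum1_count big_enum_cond /=.
rewrite (big_morph Posz PoszD (erefl _)) [RHS]big_mkcondr /=.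
rewrite {1}/psum; apply: eq_bigr => l _.
have := alternating_psum (e01^~ l) (calt l) (cs l) (ltn_ord i).
have -> : col_partial_sum A i l = psum (A^~ l) i.+1 by [].
by case: eqP; lia.
Qed.

Lemma csum_triangle_of A u v : is_asm A -> (u <= n)%N ->
  csum A u v = corner_of (triangle_of A) u v.
Proof.
move=> asmA; case: u => [|i] un; first by rewrite csum0l.
by rewrite /= (nth_triangle_of A (Ordinal un)) -csum_asm_row.
Qed.

Lemma triangle_of_rows A : is_asm A -> triangle_rows (triangle_of A).
Proof.
move=> asmA; split; first by rewrite size_map size_enum_ord.
move=> i lt_in; rewrite (nth_triangle_of A (Ordinal lt_in)) asm_row_sorted.
split=> //; have := csum_asm_row (Ordinal lt_in) n asmA.
rewrite (cornernr (asm_corner asmA)) //= => e.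
have <- : count (fun y => y <= n)%N (asm_row A (Ordinal lt_in)) =
          size (asm_row A (Ordinal lt_in)).
  by apply/eqP; rewrite -all_count; apply/allP => y /mapP[j _ ->].
by lia.
Qed.

Lemma triangle_of_corner A : is_asm A -> corner n (corner_of (triangle_of A)).
Proof.
move=> asmA; apply: eq_corner (asm_corner asmA) => u v un vn.
by rewrite csum_triangle_of.
Qed.

Lemma entry_bound t i c : triangle_rows t -> corner n (corner_of t) ->
  (c <= i < n)%N -> (entry t i c <= n)%N.
Proof. by move=> tr cC ci; rewrite entry_le // (cornernr cC); lia. Qed.

(** An entry is determined by its upper bounds, and [entry_le] reads these off the corner
    function. *)
Lemma eq_triangle t t' : triangle_rows t -> triangle_rows t' ->
  corner n (corner_of t) ->
  (forall u v, (u <= n)%N -> (v <= n)%N -> corner_of t' u v = corner_of t u v) ->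
  t' = t.
Proof.
move=> tr tr' cC e; have cC' := eq_corner e cC.
have [sz rows] := tr; have [sz' rows'] := tr'.
apply: (@eq_from_nth _ [::]); first by rewrite sz sz'.
move=> i; rewrite sz' => lt_in.
have [r _] := rows i lt_in; have [r' _] := rows' i lt_in.
apply: (@eq_from_nth _ 0%N); first by rewrite r r'.
move=> c; rewrite r' ltnS => ci; have cin : (c <= i < n)%N by rewrite ci.
rewrite -/(entry t' i c) -/(entry t i c).
have b := entry_bound tr cC cin; have b' := entry_bound tr' cC' cin.
have h : forall v, (v <= n)%N -> (entry t i c <= v)%N = (entry t' i c <= v)%N.
  by move=> v vn; rewrite !entry_le // e.
by have := h _ b; have := h _ b'; rewrite !leqnn; lia.
Qed.

Lemma triangle_of_monotone A : (0 < n)%N -> is_asm A ->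
  monotone_triangle n (triangle_of A).
Proof.
move=> n0 asmA; have tr := triangle_of_rows asmA; have cC := triangle_of_corner asmA.
have eE := entry_le _ tr; have [sz rows] := tr; have bd := entry_bound tr cC.
split.
- by split=> // i /rows[].
- move=> i c lt_in ci; have [r so] := rows i lt_in.
  by apply: (sortedP 0%N so); rewrite r.
- move=> i c lt_in ci; have c1 : (c <= i < n)%N by lia.
  have c2 : (c <= i.+1 < n)%N by lia.
  rewrite eE //; have := eE i c (entry (triangle_of A) i c) c1; rewrite leqnn.
  by have := cornerSl cC lt_in (bd _ _ c1); lia.
- move=> i c lt_in ci; have c1 : (c <= i < n)%N by lia.
  have c2 : (c.+1 <= i.+1 < n)%N by lia.
  rewrite eE //.
  have := eE i.+1 c.+1 (entry (triangle_of A) i.+1 c.+1) c2; rewrite leqnn.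
  by have := cornerSl cC lt_in (bd _ _ c2); lia.
have lt1 : (n.-1 < n)%N by lia.
have [r so] := rows _ lt1.
apply: (@eq_from_nth _ 0%N); first by rewrite r size_iota prednK.
move=> c; rewrite r prednK // => cn; have c1 : (c <= n.-1 < n)%N by lia.
rewrite nth_iota // -/(entry _ n.-1 c).
have := bd _ _ c1; have h v := eE n.-1 c v c1; move: h; rewrite prednK // => h.
have := h c.+1; have := h c; rewrite !(cornernl cC) ?(ltnW cn) //.
by lia.
Qed.

Lemma monotone_rows t : monotone_triangle n t -> triangle_rows t.
Proof.
case=> [[sz rows] inc _ _ _]; split=> // i lt_in; split; first exact: rows.
by apply/(sortedP 0%N) => c; rewrite rows // ltnS; apply: inc.
Qed.

Lemma monotone_corner t : (0 < n)%N -> monotone_triangle n t ->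
  corner n (corner_of t).
Proof.
move=> n0 mt; have tr := monotone_rows mt.
have eE := entry_le _ tr; have bd := corner_of_bound _ tr.
case: mt => _ inc colm diag bot.
have botE c : (c < n)%N -> entry t n.-1 c = c.+1.
  by move=> cn; rewrite /entry bot nth_iota.
have ge1 i c : (c <= i < n)%N -> (0 < entry t i c)%N.
  have [m] := ubnP (n - i)%N; elim: m i => [//|m IHm] i ltm ci.
  have [e|lt_n] : i = n.-1 \/ (i.+1 < n)%N by lia.
    by rewrite e botE //; lia.
  have := IHm i.+1; have := colm i c; lia.
have len i c : (c <= i < n)%N -> (entry t i c <= n)%N.
  have [m] := ubnP (n - i)%N; elim: m i c => [//|m IHm] i c ltm ci.
  have [e|lt_n] : i = n.-1 \/ (i.+1 < n)%N by lia.
    by rewrite e botE //; lia.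
  have := IHm i.+1 c.+1; have := diag i c; lia.
have last i v (c := `|corner_of t i.+1 v|%N) : (i < n)%N -> c%:Z = corner_of t i.+1 v.
  by move=> /(bd i v); rewrite /c; lia.
split.
- by [].
- case=> [//|i] lt_in; have cE := last i 0%N lt_in; have := bd i 0%N lt_in.
  have := eE i 0%N 0%N; have := ge1 i 0%N; lia.
- move=> v vn; have e : n.-1.+1 = n by lia.
  rewrite -{1}e.
  have lt1 : (n.-1 < n)%N by lia.
  have cE := last n.-1 v lt1; have := bd n.-1 v lt1.
  set c := `|_|%N in cE; have := eE n.-1 c v; have := botE c.
  by have := eE n.-1 v v; have := botE v; lia.
- case=> [//|i] lt_in; have := bd i n lt_in.
  by have := eE i i n; have := len i i; lia.
- case=> [|i] v lt_in vn; first by have := bd 0%N v lt_in; rewrite /=; lia.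
  have b1 := bd i v (ltnW lt_in); have b2 := bd i.+1 v lt_in.
  have cE := last i v (ltnW lt_in); have cE' := last i.+1 v lt_in.
  set c := `|_|%N in cE; set c' := `|_|%N in cE'.
  (* With [c] and [c'] entries at most [v] in rows [i] and [i.+1], the last ones have indices [c.-1]
     and [c'.-1]. Going down a column from the first gives [c <= c']; going up a diagonal from the
     second gives [c' <= c.+1]. Since [c'.-2] truncates, [c' < 2] is separate. *)
  have h1 := eE i c.-1 v; have h2 := eE i.+1 c.-1 v.
  have h3 := eE i.+1 c'.-1 v; have h4 := eE i c'.-2 v.
  have h5 := colm i c.-1; have h6 := diag i c'.-2.
  apply/andP; split.
    by lia.
  have [c0|c0] : (c' < 2)%N \/ c'.-2.+1 = c'.-1 by lia.
    by lia.
  by rewrite c0 in h6; lia.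
case=> [|i] v lt_in vn //.
have b1 := bd i v lt_in; have b2 := bd i v.+1 lt_in.
have cE := last i v lt_in; have cE' := last i v.+1 lt_in.
set c := `|_|%N in cE; set c' := `|_|%N in cE'.
have h1 := eE i c.-1 v; have h2 := eE i c.-1 v.+1.
have h3 := eE i c'.-1 v.+1; have h4 := eE i c'.-2 v.
have h5 := inc i c'.-2 lt_in.
apply/andP; split; first by lia.
have [c0|c0] : (c' < 2)%N \/ c'.-2.+1 = c'.-1 by lia.
  by lia.
by rewrite c0 in h5; lia.
Qed.

End Triangles.

Theorem theorem3p8 (n : nat) (hn : (0 < n)%N) :
  set_bij
    [set A : 'M[int]_n | is_asm A /\ key_avoids A [:: 3; 1; 2]%N]%classic
    [set t : seq (seq nat) | monotone_triangle n t /\ gapless n t]%classic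
    (@triangle_of n)
  /\ (forall A : 'M[int]_n, is_asm A ->
        (key_avoids A [:: 3; 1; 2]%N <-> gapless n (triangle_of A))).
Proof.
have equiv (A : 'M[int]_n) : is_asm A ->
    (key_avoids A [:: 3; 1; 2]%N <-> gapless n (triangle_of A)).
  move=> asmA; rewrite key_avoids_has_gap // gapless_has_gap.
  - rewrite -(@eq_has_gap n (csum A) (corner_of (triangle_of A))) // => u v un _.
    by rewrite csum_triangle_of.
  - exact: triangle_of_rows.
  - exact: triangle_of_corner.
split=> //; split.
- move=> A [asmA ka]; split; first exact: triangle_of_monotone.
  exact/equiv.
- move=> A A' /set_mem[asmA _] /set_mem[asmA' _] e.
  by apply: csum_inj => u v un vn; rewrite !csum_triangle_of // e.
move=> t [mt gt].
have tr := monotone_rows mt; have cC := monotone_corner hn mt.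
(* Surjectivity: the entries of the preimage are the mixed differences of the corner function of
   [t]. *)
pose A := matrix_of_corner n (corner_of t).
have csE u v : (u <= n)%N -> (v <= n)%N -> csum A u v = corner_of t u v.
  exact: csum_matrix_of_corner.
have asmA : is_asm A by apply/corner_asm/(eq_corner csE).
have eA : triangle_of A = t.
  apply: eq_triangle tr (triangle_of_rows asmA) cC _ => u v un vn.
  by rewrite -csum_triangle_of // csE.
by exists A => //; split=> //; apply/equiv => //; rewrite eA.
Qed.
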